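(* Any complex manifold $M$ of dimension $N$ admits an atlas (that is, a collection of open charts covering $M$) such that, for any point of $M$, the union of the charts containing the point is holomorphically embeddable into an open set in $\mathbb{C}^N$.
   Context: Manifolds are assumed connected, paracompact and Hausdorff (hence metrizable). *)

(* Defs.v *)
From HB Require Import structures.
From mathcomp Require Import all_boot all_order all_algebra.
From mathcomp Require Import complex.
From mathcomp Require Import all_classical all_reals all_analysis.

Set Implicit Arguments.
Unset Strict Implicit.
Unset Printing Implicit Defensive.

Import Order.TTheory GRing.Theory Num.Theory.
Import numFieldNormedType.Exports.

Local Open Scope classical_set_scope.
Local Open Scope ring_scope.
Local Open Scope complex_scope.

(* R[i] itself carries no topological instance; as a [numFieldType] it gets the
   topology of the modulus, and 'rV[CC R]_N the product topology. *)
Definition CC (R : realType) : numFieldType := R[i].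

Section Paracompact.
Variable T : topologicalType.

Definition open_cover (F : set (set T)) : Prop :=
  F `<=` open /\ \bigcup_(U in F) U = [set: T].

Definition refines (G F : set (set T)) : Prop :=
  forall V, G V -> exists2 U, F U & V `<=` U.

Definition locally_finite (G : set (set T)) : Prop :=
  forall x : T, exists2 B, nbhs x B & finite_set [set V | G V /\ V `&` B !=set0].

Definition paracompact_space : Prop :=
  forall F, open_cover F ->
  exists G, [/\ open_cover G, refines G F & locally_finite G].

End Paracompact.

(* [differentiable] is Frechet differentiability over the scalar field of the
   normed modules, here the complex numbers, so the differential is C-linear.
   This predicate is only used on open sets [A]. *)
Definition holomorphic (R : realType) (V W : normedModType (CC R))
    (A : set V) (f : V -> W) : Prop :=
  forall z, A z -> differentiable f z.

(* A chart is a homeomorphism from an open subset of [T] onto an open subset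
   of C^N. The maps are total; their values outside [chart_dom], respectively
   outside the image of [chart_dom], are irrelevant. *)
Record chart (R : realType) (N : nat) (T : topologicalType) := Chart {
  chart_dom : set T;
  chart_map :> T -> 'rV[CC R]_N;
  chart_inv : 'rV[CC R]_N -> T;
  chart_dom_open : open chart_dom;
  chart_img_open : open (chart_map @` chart_dom);
  chart_mapK : {in chart_dom, cancel chart_map chart_inv};
  chart_map_continuous : {in chart_dom, continuous chart_map};
  chart_inv_continuous : {in chart_map @` chart_dom, continuous chart_inv}
}.

Definition holomorphic_transition (R : realType) (N : nat) (T : topologicalType)
    (c c' : chart R N T) : Prop :=
  holomorphic (c @` (chart_dom c `&` chart_dom c')) (c' \o chart_inv c).

(* [complex_atlas] is any atlas defining the holomorphic structure; it is not
   required to be maximal. *)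
Record complexManifold (R : realType) (N : nat) := ComplexManifold {
  manifold_carrier :> topologicalType;
  complex_atlas : set (chart R N manifold_carrier);
  complex_atlas_cover :
    \bigcup_(c in complex_atlas) chart_dom c = [set: manifold_carrier];
  complex_atlas_transition : forall c c', complex_atlas c -> complex_atlas c' ->
    holomorphic_transition c c';
  manifold_connected : connected [set: manifold_carrier];
  manifold_hausdorff : hausdorff_space manifold_carrier;
  manifold_paracompact : paracompact_space manifold_carrier
}.

Section Manifold.
Variables (R : realType) (N : nat) (M : complexManifold R N).

(* The charts of the maximal atlas of [M]. *)
Definition holomorphic_chart (c : chart R N M) : Prop :=
  forall c', complex_atlas c' ->
  holomorphic_transition c c' /\ holomorphic_transition c' c.

Definition is_atlas (A : set (chart R N M)) : Prop :=
  A `<=` holomorphic_chart /\ \bigcup_(c in A) chart_dom c = [set: M].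

Definition union_charts_at (A : set (chart R N M)) (p : M) : set M :=
  \bigcup_(c in [set c | A c /\ chart_dom c p]) chart_dom c.

Section Embedding.
Variables (k : nat) (W : set M) (f : M -> 'rV[CC R]_k).

Definition holomorphic_on : Prop :=
  forall c, complex_atlas c ->
  holomorphic (c @` (chart_dom c `&` W)) (f \o chart_inv c).

Definition immersion_on : Prop :=
  forall c, complex_atlas c -> forall z, (c @` (chart_dom c `&` W)) z ->
  injective ('d (f \o chart_inv c) z).

(* [f] restricts to a homeomorphism from the open set [W] onto its image with
   the subspace topology. *)
Definition topological_embedding_on : Prop :=
  [/\ {in W, continuous f}, set_inj W f &
      forall U, open U -> U `<=` W ->
        exists2 O, open O & f @` U = f @` W `&` O].

Definition holomorphic_embedding_on : Prop :=
  [/\ holomorphic_on, immersion_on & topological_embedding_on].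

End Embedding.

(* Source and target have the same dimension, so an embedding of [W] identifies
   it with an open set; [V] is that open set. *)
Definition holomorphically_embeddable (W : set M) (V : set 'rV[CC R]_N) : Prop :=
  exists2 f : M -> 'rV[CC R]_N, holomorphic_embedding_on W f & f @` W = V.

End Manifold.

(* Main.v *)
Require Import Defs.
From mathcomp Require Import all_boot all_order all_algebra.
From mathcomp Require Import complex.
From mathcomp Require Import all_classical all_reals all_analysis.
Import numFieldNormedType.Exports.
Local Open Scope classical_set_scope.
Local Open Scope ring_scope.
Local Open Scope complex_scope.

(** A complex manifold [M] is paracompact and Hausdorff, so the cover of [M] by
    the domains of its charts has an open barycentric refinement [H]: for every
    point [p], all members of [H] containing [p] lie together in the domain of
    one chart [c0] ([barycentric_refinement]). Cutting every chart down to every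
    member of [H] yields an atlas. The charts of this atlas that contain [p] have
    their union inside the domain of [c0], and [c0] itself embeds that union onto
    an open subset of C^N ([chart_embeds_open]).

    The refinement is obtained from a locally finite open cover [G] such that the
    closure of each [V] in [G] lies in some member [U V] of the given cover; such
    a [G] exists because paracompact Hausdorff spaces are regular
    ([paracompact_regular]). To each point [q] one attaches the set of all [x]
    that lie in [U V] for every [V] whose closure contains [q], and that avoid
    the closure of every other [V]. By local finiteness this is a neighbourhood
    of [q]. If [p] belongs to the closure of [V] and to the neighbourhood of [q],
    then [q] belongs to the closure of [V], so that the neighbourhood of [q] is
    contained in [U V]: the same member for all such [q]. *)

Set Implicit Arguments.
Unset Strict Implicit.
Unset Printing Implicit Defensive.

(** * Barycentric refinements in paracompact Hausdorff spaces *)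

Section Topology.
Variable T : topologicalType.

(** Near [p] all but finitely many [V] in [G] are avoided, together with their
    closures, so all but finitely many of the conditions [S V] hold trivially. *)
Lemma locally_finite_nbhs (G : set (set T)) (S : set T -> set T) (p : T) :
  locally_finite G ->
  (forall V, G V -> nbhs p (S V)) ->
  (forall V, G V -> ~ closure V p -> ~` closure V `<=` S V) ->
  nbhs p (\bigcap_(V in G) S V).
Proof.
move=> /(_ p)[B pB finD] pS SE.
have [D DE] := finite_fsetP.1 finD.
have pD : nbhs p (\bigcap_(V in [set V | G V /\ V `&` B !=set0]) S V).
  rewrite DE; apply: filter_bigI => V VD; apply: pS.
  by have : [set V | G V /\ V `&` B !=set0] V by [rewrite DE]; case.
have pI : nbhs p B° by apply: nbhs_interior.
apply: filterS (filterI pD pI) => x [xD xI] V GV.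
have [VD|nVD] := pselect ([set V | G V /\ V `&` B !=set0] V).
  exact: xD.
have ncl y : B° y -> ~ closure V y.
  by move=> By /(_ B By) VB; apply: nVD.
by apply: SE => //; apply: ncl => //; exact: nbhs_singleton.
Qed.

(** Points outside an open [U] around [a] have open neighbourhoods whose closure
    misses [a]. In a locally finite refinement of the cover formed by these
    neighbourhoods and [U], the members not contained in [U] cover the complement
    of [U], while near [a] their closures can all be avoided at once. *)
Lemma paracompact_regular :
  hausdorff_space T -> paracompact_space T -> regular_space T.
Proof.
rewrite open_hausdorff => sepT parT a U0 /= aU0.
pose U := U0°.
pose F := [set O : set T | open O /\ (O = U \/ ~ closure O a)].
have coverF : open_cover F.
  split; first by move=> O [].
  rewrite -subTset => y _.
  have [Uy|nUy] := pselect (U y).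
    by exists U => //; split; [exact: open_interior | left].
  have ay : a != y.
    apply/eqP => ay; apply: nUy; rewrite -ay.
    exact: nbhs_singleton (nbhs_interior aU0).
  have [[A B] /= [aA yB] [oA oB /eqP AB0]] := sepT a y ay.
  exists B; last exact: set_mem.
  split=> //; right=> /(_ A); case.
    by apply: open_nbhs_nbhs; split => //; exact: set_mem.
  by move=> z [Bz Az]; have : (A `&` B) z by []; rewrite AB0.
have [G [[Gopen Gcover] Gref Gfin]] := parT F coverF.
pose S V := [set x | V `<=` U \/ ~ closure V x].
exists (\bigcap_(V in G) S V).
  apply: locally_finite_nbhs => //; last by move=> V GV _ x; right.
  move=> V GV.
  have [VU|nVU] := pselect (V `<=` U).
    by apply: filterS filterT => x _; left.
  apply: (@filterS _ _ _ (~` closure V)); first by move=> x; right.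
  apply: open_nbhs_nbhs; split; first exact/closed_openC/closed_closure.
  have [Q [_ [QU|nQa]] VQ] := Gref V GV; first by rewrite QU in VQ.
  by move=> Va; apply: nQa; exact: closure_subset VQ _ Va.
move=> y cly; apply: contrapT => nU0y.
have [V GV Vy] : (\bigcup_(V in G) V) y by rewrite Gcover.
have nVU : ~ V `<=` U by move=> /(_ y Vy) /interior_subset.
have Vnbhs : nbhs y V by apply: open_nbhs_nbhs; split => //; exact: Gopen.
have [x [Sx Vx]] := cly V Vnbhs.
by case: (Sx V GV) => // /(_ (subset_closure Vx)).
Qed.

(** The neighbourhood of [q] is cut out by one condition for each member [V] of
    a locally finite cover [G] whose closures lie inside members of [F]. The
    half [closure V x -> closure V q] of it is what makes the member of [F]
    depend on [p] alone: any [V] containing [p] also has [q] in its closure,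
    whichever neighbourhood containing [p] is considered. *)
Lemma barycentric_refinement (F : set (set T)) :
  hausdorff_space T -> paracompact_space T -> open_cover F ->
  exists2 H, open_cover H &
    forall p, exists2 U, F U & \bigcup_(W in [set W | H W /\ W p]) W `<=` U.
Proof.
move=> sepT parT [Fopen Fcover].
have regT := paracompact_regular sepT parT.
pose F' := [set O : set T | open O /\ exists2 U, F U & closure O `<=` U].
have coverF' : open_cover F'.
  split; first by move=> O [].
  rewrite -subTset => p _.
  have [U FU Up] : (\bigcup_(U in F) U) p by rewrite Fcover.
  have [B pB BU] : filter_from (nbhs p) closure U.
    by apply: regT; apply: open_nbhs_nbhs; split => //; exact: Fopen.
  exists B°; last exact: nbhs_singleton (nbhs_interior pB).
  split; first exact: open_interior.
  exists U => //; apply: subset_trans BU.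
  by apply: closure_subset; exact: interior_subset.
have [G [[Gopen Gcover] Gref Gfin]] := parT F' coverF'.
have /choice[u uP] : forall V, exists U, G V -> F U /\ closure V `<=` U.
  move=> V; have [GV|nGV] := pselect (G V); last by exists set0.
  have [Q [_ [U FU QU]] VQ] := Gref V GV; exists U => _; split => //.
  by apply: subset_trans QU; exact: closure_subset.
pose S q V := [set x | (closure V q -> u V x) /\ (closure V x -> closure V q)].
pose W q := \bigcap_(V in G) S q V.
have nbhsW q : nbhs q (W q).
  apply: locally_finite_nbhs => // V GV.
  have [FuV VuV] := uP V GV.
  have [Vq|nVq] := pselect (closure V q).
    have: nbhs q (u V).
      by apply: open_nbhs_nbhs; split; [exact: Fopen | exact: VuV].
    by apply: filterS => x ux; split.
  have: nbhs q (~` closure V).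
    by apply: open_nbhs_nbhs; split=> //; exact/closed_openC/closed_closure.
  by apply: filterS => x nVx; split.
exists (range (fun q => (W q)°)).
  split; first by move=> _ [q _ <-]; exact: open_interior.
  rewrite -subTset => q _; exists (W q)°; first by exists q.
  exact: nbhs_singleton (nbhs_interior (nbhsW q)).
move=> p.
have [V GV Vp] : (\bigcup_(V in G) V) p by rewrite Gcover.
exists (u V); first by have [] := uP V GV.
move=> x [_ [[q _ <-] /interior_subset Wp] /interior_subset Wx].
have [_ /(_ (subset_closure Vp)) Vq] := Wp V GV.
by have [/(_ Vq)] := Wx V GV.
Qed.

End Topology.

(** * Differentials of local inverses *)

(** Chain rule at [z]: near [z] the composite is the identity, which is its own
    differential. *)
Lemma diff_local_cancel (K : numFieldType) (V W : normedModType K)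
    (f : V -> W) (g : W -> V) (z : V) :
  differentiable f z -> differentiable g (f z) ->
  (\forall w \near z, (g \o f) w = id w) -> cancel ('d f z) ('d g (f z)).
Proof.
move=> df dg gfK v.
have gfE : 'd (g \o f) z v = 'd g (f z) ('d f z v) by rewrite diff_comp.
rewrite -gfE -deriveE; last exact: differentiable_comp.
by rewrite (near_eq_derive _ gfK) derive_id.
Qed.

(** * Charts of a complex manifold *)

Section Charts.
Variables (R : realType) (N : nat) (T : topologicalType).
Implicit Types c : chart R N T.

(** The image of a chart is open and the inverse of the chart is continuous on
    it, so points near [c x] have their preimage in [U]. *)
Lemma open_chart_image c (U : set T) :
  open U -> U `<=` chart_dom c -> open (c @` U).
Proof.
move=> oU Uc; rewrite openE => _ [x Ux <-].
have cx : (c @` chart_dom c) (c x) by exists x => //; exact: Uc.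
have invU : nbhs (c x) (chart_inv c @^-1` U).
  apply: (chart_inv_continuous (mem_set cx)).
  by rewrite chart_mapK ?inE; [exact: open_nbhs_nbhs | exact: Uc].
have img : nbhs (c x) (c @` chart_dom c).
  by apply: open_nbhs_nbhs; split => //; exact: chart_img_open.
apply: filterS (filterI img invU) => _ [[y cy <-]] /=.
by rewrite chart_mapK ?inE // => Uy; exists y.
Qed.

Lemma chart_restrict_img_open c (W : set T) : open W ->
  open (c @` (chart_dom c `&` W)).
Proof.
move=> oW; apply: open_chart_image; last exact: subIsetl.
by apply: openI => //; exact: chart_dom_open.
Qed.

Definition chart_restrict c (W : set T) (oW : open W) : chart R N T :=
  @Chart R N T (chart_dom c `&` W) c (chart_inv c)
    (openI (chart_dom_open c) oW) (chart_restrict_img_open oW)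
    (sub_in1 (fun x (xW : x \in chart_dom c `&` W) =>
       mem_set (set_mem xW).1) (@chart_mapK _ _ _ c))
    (sub_in1 (fun x (xW : x \in chart_dom c `&` W) =>
       mem_set (set_mem xW).1) (@chart_map_continuous _ _ _ c))
    (sub_in1 (fun z (zW : z \in c @` (chart_dom c `&` W)) =>
       mem_set (image_subset c (@subIsetl _ _ _) _ (set_mem zW)))
       (@chart_inv_continuous _ _ _ c)).

(** The transition map back from [c'] to [c] is a differentiable local left
    inverse. *)
Lemma transition_diff_inj c c' (z : 'rV[CC R]_N) :
  holomorphic_transition c c' -> holomorphic_transition c' c ->
  (c @` (chart_dom c `&` chart_dom c')) z ->
  injective ('d (c' \o chart_inv c) z).
Proof.
move=> hcc' hc'c zcc'.
set f := c' \o chart_inv c; set g := c \o chart_inv c'.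
have df : differentiable f z by exact: hcc'.
have dg : differentiable g (f z).
  case: zcc' => x [cx c'x] <-; apply: hc'c.
  by exists x => //=; rewrite /f /= chart_mapK ?inE.
have gfK : \forall w \near z, (g \o f) w = id w.
  have : nbhs z (c @` (chart_dom c `&` chart_dom c')).
    apply: open_nbhs_nbhs; split => //.
    by apply: chart_restrict_img_open; exact: chart_dom_open.
  apply: filterS => _ [x [cx c'x] <-].
  by rewrite /g /f /= chart_mapK ?inE // chart_mapK ?inE.
exact: can_inj (diff_local_cancel df dg gfK).
Qed.

End Charts.

Section Manifold.
Variables (R : realType) (N : nat) (M : complexManifold R N).

(** Transition maps from charts of the atlas to [c0] express the map [c0] in
    coordinates, which gives holomorphy and, by their invertibility, the
    immersion property; [c0] being a homeomorphism gives the rest. *)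
Lemma chart_embeds_open (c0 : chart R N M) (W : set M) :
  complex_atlas c0 -> open W -> W `<=` chart_dom c0 ->
  holomorphically_embeddable W (c0 @` W).
Proof.
move=> Ac0 oW Wc0; exists c0 => //; split.
- move=> c Ac z cWz; apply: (complex_atlas_transition Ac Ac0).
  by apply: image_subset cWz; exact: setIS.
- move=> c Ac z cWz; apply: transition_diff_inj.
  + exact: complex_atlas_transition.
  + exact: complex_atlas_transition.
  + by apply: image_subset cWz; exact: setIS.
- split.
  + move=> x /set_mem /Wc0 /mem_set; exact: chart_map_continuous.
  + move=> x y /set_mem/Wc0/mem_set c0x /set_mem/Wc0/mem_set c0y.
    by move=> /(congr1 (chart_inv c0)); rewrite !chart_mapK.
  + move=> U oU UW; exists (c0 @` U).
      by apply: open_chart_image => //; exact: subset_trans Wc0.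
    by apply/esym/setIidPr; exact: image_subset.
Qed.

(** Holomorphy of the transition maps is inherited by smaller domains. *)
Lemma holomorphic_chart_restrict (c : chart R N M) (W : set M) (oW : open W) :
  complex_atlas c -> holomorphic_chart (chart_restrict c oW).
Proof.
move=> Ac c' Ac'; split=> z zW.
  apply: (complex_atlas_transition Ac Ac'); apply: image_subset zW.
  by apply: setSI; exact: subIsetl.
apply: (complex_atlas_transition Ac' Ac); apply: image_subset zW.
by apply: setIS; exact: subIsetl.
Qed.

End Manifold.

Theorem lemma3p3 (R : realType) (N : nat) (M : complexManifold R N) :
  exists A : set (chart R N M), is_atlas A /\
    forall p : M, exists2 V : set 'rV[CC R]_N, open V &
      holomorphically_embeddable (union_charts_at A p) V.
Proof.
pose F := [set U : set M | exists2 c, complex_atlas c & U = chart_dom c].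
have coverF : open_cover F.
  split; first by move=> _ [c _ ->]; exact: chart_dom_open.
  rewrite -(complex_atlas_cover M) eqEsubset; split => x.
    by move=> [_ [c Ac ->] cx]; exists c.
  by move=> [c Ac cx]; exists (chart_dom c) => //; exists c.
have [H [Hopen Hcover] Hstar] :=
  barycentric_refinement (@manifold_hausdorff _ _ M)
    (@manifold_paracompact _ _ M) coverF.
pose A := [set c' | exists c W (oW : open W),
  [/\ complex_atlas c, H W & c' = chart_restrict c oW]].
exists A; split.
  split.
    by move=> _ [c [W [oW [Ac _ ->]]]]; exact: holomorphic_chart_restrict.
  rewrite -subTset => x _.
  have [c Ac cx] : (\bigcup_(c in @complex_atlas _ _ M) chart_dom c) x.
    by rewrite complex_atlas_cover.
  have [W HW Wx] : (\bigcup_(W in H) W) x by rewrite Hcover.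
  exists (chart_restrict c (Hopen W HW)) => //.
  by exists c, W, (Hopen W HW).
move=> p.
have [_ [c0 Ac0 ->] starp] := Hstar p.
set W := union_charts_at A p.
have oW : open W by apply: bigcup_open => c _; exact: chart_dom_open.
have Wc0 : W `<=` chart_dom c0.
  move=> x [_ [[c [Q [oQ [Ac HQ ->]]]] [_ Qp]] [_ Qx]].
  by apply: starp; exists Q.
exists (c0 @` W); first exact: open_chart_image.
exact: chart_embeds_open.
Qed.
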